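(* Let $G$, $\Theta$, $\mathcal H$, $\{\rho_\theta\}$, $\overline{\mathcal Q}=\{\bar\rho_\eta:\eta\in\Theta/G\}$, $\mathcal A_G$, and the finite block decomposition with central projections $\Pi_z$, $z\in\mathsf Z$, be as described in the context, and put $p_\eta(z):=\operatorname{Tr}(\bar\rho_\eta\Pi_z)$. Suppose that the block-label measurement $M^\star(\{z\})=\Pi_z$, $z\in\mathsf Z$, is quantum-to-classically sufficient for $\overline{\mathcal Q}$ relative to all $G$-invariant POVMs. Then for every invariant effect $E$ (that is, $E\in\mathcal A_G$ with $0\le E\le I$) there exists a function $f_E:\mathsf Z\to[0,1]$ such that $$\operatorname{Tr}(\bar\rho_\eta E)=\sum_{z\in\mathsf Z}p_\eta(z)f_E(z)\qquad\text{for every }\eta\in\Theta/G.$$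
   Context: **Symmetric model.** $G$ is a compact Hausdorff group with normalized Haar measure $dg$, acting measurably on a parameter space $\Theta$; $g\mapsto U_g$ is a strongly continuous unitary representation of $G$ on a separable complex Hilbert space $\mathcal H$; $\{\rho_\theta:\theta\in\Theta\}$ is a family of density operators on $\mathcal H$ with $\rho_{g\theta}=U_g\rho_\theta U_g^\dagger$ for all $g,\theta$. $\Theta/G$ is the orbit space and $\pi:\Theta\to\Theta/G$ the quotient map. The orbit-averaged state is $\bar\rho_\eta:=\int_G U_g\rho_\theta U_g^\dagger\,dg$ (trace-norm Bochner integral) for any $\theta$ with $\pi(\theta)=\eta$; it does not depend on the choice of $\theta$. **Blocks.** $\mathcal A_G:=\{A\in\mathcal L(\mathcal H):[A,U_g]=0\ \forall g\in G\}$, where $\mathcal L(\mathcal H)$ denotes the bounded operators. $\mathsf Z$ is a finite set and $\mathcal H=\bigoplus_{z\in\mathsf Z}\mathcal H_z$ is an orthogonal decomposition into nonzero subspaces whose orthogonal projections $\Pi_z$ are central in $\mathcal A_G$. **POVMs and sufficiency.** A POVM $M$ on $\mathcal H$ with outcome space $(\mathsf Y,\mathcal Y)$ is a map from $\mathcal Y$ to positive bounded operators that is countably additive in the weak operator topology, with $M(\mathsf Y)=I$; outcome spaces are standard Borel. $M$ is $G$-invariant if $U_g^\dagger M(B)U_g=M(B)$ for all $g$ and $B$. For a family of states $\mathcal Q=\{\sigma_\eta\}$, put $P^M_\eta(B):=\operatorname{Tr}[\sigma_\eta M(B)]$. A measurement $M^\star$ in a class $\mathfrak M$ of POVMs is *quantum-to-classically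 sufficient* for $\mathcal Q$ relative to $\mathfrak M$ if for every $N\in\mathfrak M$ there is a Markov kernel $K_N$ (not depending on $\eta$) from the outcome space of $M^\star$ to that of $N$ with $P^N_\eta(B)=\int K_N(x,B)\,P^{M^\star}_\eta(dx)$ for all $\eta$ and all measurable $B$. *)

(* Defs.v *)
From HB Require Import structures.
From mathcomp Require Import all_boot all_order all_algebra.
From mathcomp Require Import complex.
From mathcomp Require Import all_classical all_reals all_analysis measurable_realfun.

Set Implicit Arguments.
Unset Strict Implicit.
Unset Printing Implicit Defensive.

Import Order.TTheory GRing.Theory Num.Theory numFieldNormedType.Exports.

Local Open Scope classical_set_scope.
Local Open Scope ring_scope.
Local Open Scope complex_scope.

(* {dot H for conjC} is linear in its first argument and conjugate-linear in
   its second one; all notions below are insensitive to this convention. *)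
HB.mixin Record NormedModule_isHilbert (R : realType) H
    of CompleteNormedModule R[i] H := {
  inner_form : {dot H for Num.conj_op} ;
  inner_formE : forall x : H, inner_form x x = `|x| ^+ 2 }.

#[short(type="hilbertType")]
HB.structure Definition Hilbert (R : realType) :=
  {H of CompleteNormedModule R[i] H & NormedModule_isHilbert R H}.

Definition inner {R : realType} {H : hilbertType R} (x y : H) : R[i] :=
  @inner_form R H x y.

Definition separable_space (T : topologicalType) :=
  exists D : set T, countable D /\ dense D.

Section Operators.
Context {R : realType} {H : hilbertType R}.
Implicit Types (A B P : H -> H) (e : nat -> H) (V : set H).

Definition bounded_operator A := linear A /\ continuous A.

(* On R[i], 0 <= z means that z is a nonnegative real. *)
Definition positive_operator A := forall x, 0 <= inner (A x) x.

Definition is_adjoint A B := forall x y, inner (A x) y = inner x (B y).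

Definition adjoint A : H -> H := xget 0 [set B | is_adjoint A B].

Definition unitary_operator A :=
  [/\ bounded_operator A, adjoint A \o A = id & A \o adjoint A = id].

Definition orthogonal_projection_on V P :=
  forall x, V (P x) /\ forall y, V y -> inner (x - P x) y = 0.

(* The nonzero e n form an orthonormal basis; zero terms are allowed so that
   finite-dimensional spaces are covered too. *)
Definition orthonormal_basis e :=
  [/\ forall m n, m <> n -> inner (e m) (e n) = 0,
      forall n, e n = 0 \/ `|e n| = 1
    & forall x, (forall n, inner x (e n) = 0) -> x = 0].

(* A fixed basis: the traces below do not depend on it, for positive operators
   and for trace-class operators respectively. *)
Definition std_basis : nat -> H := xget (fun=> 0) orthonormal_basis.

Definition positive_trace P : \bar R :=
  (\sum_(0 <= n <oo) (complex.Re (inner (P (std_basis n)) (std_basis n)))%:E)%E.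

Definition trace A : R[i] :=
  limn (series (fun n => inner (A (std_basis n)) (std_basis n) : R[i]^o)).

(* P = |A|, the positive square root of the product of A's adjoint with A *)
Definition is_abs_operator A P :=
  [/\ bounded_operator P, positive_operator P
    & exists2 B, is_adjoint A B & P \o P = B \o A].

(* |A| is unique, so this is the trace of |A|. *)
Definition trace_norm A : \bar R :=
  ereal_inf [set positive_trace P | P in is_abs_operator A].

Definition trace_class A := bounded_operator A /\ (trace_norm A < +oo)%E.

Definition density_operator A :=
  [/\ trace_class A, positive_operator A & trace A = 1].

End Operators.

Section BochnerIntegral.
Context {R : realType} {H : hilbertType R} {d : measure_display}.
Context {T : measurableType d}.
Implicit Types (mu : probability T R) (s : seq (set T * (H -> H))).

(* The list s stands for the function sum_i 1_(E_i) * A_i, (E_i, A_i) in s. *)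
Definition simple_operator_fun s :=
  forall p, p \in s -> measurable p.1 /\ trace_class p.2.

Definition eval_simple s (x : T) : H -> H :=
  \sum_(p <- s) (\1_(p.1) x : R)%:C *: p.2.

Definition integral_simple mu s : H -> H :=
  \sum_(p <- s) (fine (mu p.1))%:C *: p.2.

Definition is_bochner_integral mu (f : T -> H -> H) (A : H -> H) :=
  (forall x, trace_class (f x)) /\ trace_class A /\
  exists s : nat -> seq (set T * (H -> H)),
    [/\ forall n, simple_operator_fun (s n),
        forall n, measurable_fun setT
          (fun x => trace_norm (f x - eval_simple (s n) x)),
        (\int[mu]_x trace_norm (f x - eval_simple (s n) x)%R)%E
          @[n --> \oo] --> 0%E
      & trace_norm (A - integral_simple mu (s n)) @[n --> \oo] --> 0%E].

End BochnerIntegral.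

HB.mixin Record isTopologicalGroup G of PointedTopological G & Group G := {
  mulg_continuous : continuous (fun x : G * G => (x.1 * x.2)%g) ;
  invg_continuous : continuous (fun x : G => (x^-1)%g) }.

#[short(type="topologicalGroupType")]
HB.structure Definition TopologicalGroup :=
  {G of PointedTopological G & Group G & isTopologicalGroup G}.

Notation borel G := (g_sigma_algebraType (@open G)).

Definition compact_hausdorff (T : topologicalType) :=
  compact [set: T] /\ hausdorff_space T.

(* A compact group is unimodular, so left invariance suffices; regularity is
   needed for uniqueness when G is not second countable. *)
Definition normalized_haar {R : realType} {G : topologicalGroupType}
    (mu : probability (borel G) R) :=
  [/\ forall (g : G) (A : set (borel G)), measurable A ->
        mu [set (g * h)%g | h in (A : set G)] = mu A,
      forall A : set (borel G), measurable A ->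
        mu A = ereal_inf [set mu V | V in [set V | @open G V /\ A `<=` V]]
    & forall V : set G, open V ->
        mu V = ereal_sup [set mu K | K in [set K | @compact G K /\ K `<=` V]]].

Section Symmetry.
Context {R : realType} {H : hilbertType R} {G : topologicalGroupType}.
Implicit Types (U : G -> H -> H).

Definition measurable_action {d} {Theta : measurableType d}
    (act : G -> Theta -> Theta) :=
  [/\ forall t, act 1%g t = t,
      forall g h t, act (g * h)%g t = act g (act h t)
    & measurable_fun [set: borel G * Theta]
        (fun p : borel G * Theta => act p.1 p.2)].

Definition strongly_continuous_unitary_rep U :=
  [/\ forall g, unitary_operator (U g),
      U 1%g = id,
      forall g h, U (g * h)%g = U g \o U h
    & forall x, continuous (fun g => U g x)].

Definition commutant U : set (H -> H) :=
  [set A | bounded_operator A /\ forall g, A \o U g = U g \o A].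

Definition central_in (S : set (H -> H)) (A : H -> H) :=
  S A /\ forall B, S B -> A \o B = B \o A.

Definition group_orbit {Theta : Type} (act : G -> Theta -> Theta) (t : Theta) :
  set Theta := [set act g t | g in setT].

Definition orbit_space {Theta : Type} (act : G -> Theta -> Theta) : Type :=
  {eta : set Theta | exists t, group_orbit act t = eta}.

(* The default value 0 plays no role: for a covariant family of states the
   integral exists and is the same for all t in the orbit eta. *)
Definition orbit_average {Theta : Type} (mu : probability (borel G) R)
    (act : G -> Theta -> Theta) U (rho : Theta -> H -> H)
    (eta : orbit_space act) : H -> H :=
  xget 0 [set A | forall t, group_orbit act t = sval eta ->
    is_bochner_integral mu (fun g => U g \o rho t \o adjoint (U g)) A].

End Symmetry.

Definition orthogonal_decomposition {R : realType} {H : hilbertType R}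
    {Z : choiceType} (V : Z -> set H) :=
  [/\ forall z a x y, V z x -> V z y -> V z (a *: x + y),
      forall z, exists2 x, V z x & x != 0,
      forall z z' x y, z <> z' -> V z x -> V z' y -> inner x y = 0
    & forall x, exists2 v : Z -> H,
        forall z, V z (v z) & x = \sum_(z \in [set: Z]) v z].

Definition finite_discrete {d} (Z : measurableType d) :=
  finite_set [set: Z] /\ forall B : set Z, measurable B.

(* Measurably isomorphic to a Polish space with its Borel sets *)
Definition standard_borel (R : realType) {d} (Y : measurableType d) :=
  exists (X : completePseudoMetricType R) (f : Y -> X),
    [/\ hausdorff_space X, separable_space X, bijective f
      & forall B : set Y, measurable B <-> <<s @open X >> (f @` B)].

Section Measurements.
Context {R : realType} {H : hilbertType R}.

Definition povm {d} {Y : measurableType d} (M : set Y -> H -> H) :=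
  [/\ forall B, measurable B ->
        bounded_operator (M B) /\ positive_operator (M B),
      M setT = id
    & forall F : (set Y)^nat, (forall n, measurable (F n)) ->
        trivIset setT F -> forall x y,
        series (fun n => inner (M (F n) x) y : R[i]^o) @ \oo -->
          (inner (M (\bigcup_n F n) x) y : R[i]^o)].

Definition invariant_povm {G : Type} (U : G -> H -> H) {d}
    {Y : measurableType d} (M : set Y -> H -> H) :=
  [/\ standard_borel R Y, povm M
    & forall g B, measurable B -> adjoint (U g) \o M B \o U g = M B].

(* Tr (sigma M(B)) is a nonnegative real for a state sigma and a POVM M. *)
Definition outcome_law {d} {Y : measurableType d} (sigma : H -> H)
    (M : set Y -> H -> H) : set Y -> \bar R :=
  fun B => (complex.Re (trace (sigma \o M B)))%:E.

Definition qc_sufficient {I : Type} (sigma : I -> H -> H)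
    (class : forall (d : measure_display) (Y : measurableType d),
       (set Y -> H -> H) -> Prop)
    {d} {X : measurableType d} (Mstar : set X -> H -> H) :=
  class d X Mstar /\
  forall (d' : measure_display) (Y : measurableType d') (N : set Y -> H -> H),
    class d' Y N ->
    exists K : R.-pker X ~> Y, forall i (B : set Y), measurable B ->
      outcome_law (sigma i) N B =
      (\int[outcome_law (sigma i) Mstar]_x K x B)%E.

Definition block_measurement {Z : choiceType} (Pi : Z -> H -> H) :
  set Z -> H -> H := fun B => \sum_(z \in B) Pi z.

Definition invariant_effect {G : topologicalGroupType} (U : G -> H -> H)
    (E : H -> H) :=
  [/\ commutant U E, positive_operator E & positive_operator (id - E)].

End Measurements.

(* Main.v *)
Require Import Defs.
From HB Require Import structures.
From mathcomp Require Import all_boot all_order all_algebra.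
From mathcomp Require Import complex.
From mathcomp Require Import all_classical all_reals all_analysis measurable_realfun.
From mathcomp Require Import ring lra.

(* An invariant effect E gives the two-outcome invariant measurement (E, 1 - E),
   so sufficiency supplies a kernel K, and f z := K z {true} satisfies the claim
   as soon as z |-> Tr (s Pi_z) is a genuine nonnegative weight and Tr (s E) is
   real, s being an orbit-averaged state.  This needs that s is positive, as a
   Bochner integral of positive operators (|<T x, y>| <= |x| |y| |T|_1), and
   that Tr (s A) converges to a nonnegative real for A bounded and positive.
   The latter avoids square roots: a Cholesky decomposition s = sum_k |v_k><v_k|
   along the basis, with sum_k |v_k|^2 <= Tr s, gives Tr (s A) = sum_k <A v_k, v_k>. *)

Set Implicit Arguments.
Unset Strict Implicit.
Unset Printing Implicit Defensive.

Import Order.TTheory GRing.Theory Num.Theory numFieldNormedType.Exports.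

Local Open Scope classical_set_scope.
Local Open Scope ring_scope.
Local Open Scope complex_scope.

(** [trace] is the limit of partial sums along one fixed basis, so both additivity and reality of Tr
    (s A) have to come from convergence; yet s A is in general not self-adjoint, and its partial
    sums are neither real nor monotone. The Cholesky columns repair this: after N steps the
    remainder kills e_0, ..., e_(N-1), so the N-th partial sum involves exactly N columns and
    differs by a vanishing error from a nondecreasing real sequence. Summability of the columns
    needs bounded partial traces of s itself, whereas [trace_class] only bounds the trace of some
    positive P with the same square as |s|. Instead of proving s = P, which is uniqueness of
    positive square roots, an extremal argument derives s <= P from |s x| = |P x|. In the same
    spirit the trace-norm bound on Re <T x, y> replaces the polar decomposition by |T x| = |P x|
    together with |P x| <= Tr P |x|. The basis, the adjoint and the orbit average are chosen by
    [xget]; their default value 0 is treated as a separate case wherever it may occur. *)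

Section InnerProduct.
Context {R : realType} {H : hilbertType R}.
Implicit Types (x y z : H) (a : R[i]).

(** Norms and inner products take values in [R[i]]; passing to real parts gives a real inner product
    and norm, where order and [lra] are available. *)
Definition re_inner x y : R := complex.Re (inner x y).
Definition hnorm x : R := complex.Re `|x|.

Lemma innerDl x y z : inner (x + y) z = inner x z + inner y z.
Proof. exact: linearDl. Qed.

Lemma innerDr x y z : inner z (x + y) = inner z x + inner z y.
Proof. exact: linearDr. Qed.

Lemma innerBl x y z : inner (x - y) z = inner x z - inner y z.
Proof. exact: linearBl. Qed.

Lemma innerBr x y z : inner z (x - y) = inner z x - inner z y.
Proof. exact: linearBr. Qed.

Lemma inner0l x : inner 0 x = 0.
Proof. exact: linear0l. Qed.

Lemma inner0r x : inner x 0 = 0.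
Proof. exact: linear0r. Qed.

Lemma innerZl a x y : inner (a *: x) y = a * inner x y.
Proof. exact: linearZl_LR. Qed.

Lemma innerZr a x y : inner x (a *: y) = a^* * inner x y.
Proof. exact: linearZr_LR. Qed.

Lemma innerC x y : inner y x = (inner x y)^*.
Proof. by rewrite /inner hermC expr0 mul1r. Qed.

Lemma inner_suml I (s : seq I) (P : pred I) (f : I -> H) y :
  inner (\sum_(i <- s | P i) f i) y = \sum_(i <- s | P i) inner (f i) y.
Proof. exact: linear_sumlz. Qed.

Lemma inner_sumr I (s : seq I) (P : pred I) (f : I -> H) y :
  inner y (\sum_(i <- s | P i) f i) = \sum_(i <- s | P i) inner y (f i).
Proof. exact: linear_sumr. Qed.

Lemma hnormE x : `|x| = (hnorm x)%:C.
Proof. by rewrite /hnorm RRe_real// ger0_real. Qed.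

Lemma hnorm_ge0 x : 0 <= hnorm x.
Proof. by rewrite -ler0c -hnormE. Qed.

Lemma innerE x : inner x x = (hnorm x ^+ 2)%:C.
Proof. by rewrite /inner inner_formE hnormE rmorphXn. Qed.

Lemma re_innerE x : re_inner x x = hnorm x ^+ 2.
Proof. by rewrite /re_inner innerE. Qed.

Lemma re_innerC x y : re_inner x y = re_inner y x.
Proof. by rewrite /re_inner innerC; case: (inner y x). Qed.

Lemma re_innerDl x y z : re_inner (x + y) z = re_inner x z + re_inner y z.
Proof. by rewrite /re_inner innerDl raddfD. Qed.

Lemma re_innerBl x y z : re_inner (x - y) z = re_inner x z - re_inner y z.
Proof. by rewrite /re_inner innerBl raddfB. Qed.

Lemma re_innerDr x y z : re_inner z (x + y) = re_inner z x + re_inner z y.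
Proof. by rewrite /re_inner innerDr raddfD. Qed.

Lemma re_innerBr x y z : re_inner z (x - y) = re_inner z x - re_inner z y.
Proof. by rewrite /re_inner innerBr raddfB. Qed.

Lemma re_inner0r x : re_inner x 0 = 0.
Proof. by rewrite /re_inner inner0r. Qed.

Lemma re_innerNr x y : re_inner x (- y) = - re_inner x y.
Proof. by rewrite -sub0r re_innerBr re_inner0r sub0r. Qed.

Lemma re_innerZl (r : R) x y : re_inner (r%:C *: x) y = r * re_inner x y.
Proof. by rewrite /re_inner innerZl; case: (inner x y) => b c /=; rewrite mul0r subr0. Qed.

Lemma re_innerZr (r : R) x y : re_inner x (r%:C *: y) = r * re_inner x y.
Proof. by rewrite re_innerC re_innerZl re_innerC. Qed.

(** This turns any bound on real parts that is uniform in y into one on imaginary parts. *)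
Lemma Im_inner x y : complex.Im (inner x y) = re_inner x ('i *: y).
Proof. by rewrite /re_inner innerZr; case: (inner x y) => b c /=; ring. Qed.

Lemma hnormi x : hnorm ('i *: x) = hnorm x.
Proof.
rewrite /hnorm normrZ (_ : `|'i| = 1 :> R[i]) ?mul1r//.
by rewrite normc_def/= expr0n expr1n add0r sqrtr1.
Qed.

Lemma hnorm_eq0 x : (hnorm x == 0) = (x == 0).
Proof. by rewrite -(normr_eq0 x) hnormE eq_complex/= eqxx andbT. Qed.

Lemma hnorm0 : hnorm 0 = 0.
Proof. by apply/eqP; rewrite hnorm_eq0. Qed.

Lemma hnorm_distC x y : hnorm (x - y) = hnorm (y - x).
Proof. by rewrite /hnorm distrC. Qed.

End InnerProduct.

(** * Linear maps and the Cauchy-Schwarz inequality for positive operators *)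

Section LinearMaps.
Context {R : realType} {H : hilbertType R}.
Implicit Types (A B P : H -> H) (x y z : H) (a : R[i]).

Lemma linear_fun_ex A : linear A -> exists L : {linear H -> H}, A = L.
Proof.
move=> hA.
by exists (HB.pack_for {linear H -> H} A (GRing.isLinear.Build _ _ _ _ A hA)).
Qed.

Lemma lin0 A : linear A -> A 0 = 0.
Proof. by case/linear_fun_ex => L ->; exact: linear0. Qed.

Lemma linB A x y : linear A -> A (x - y) = A x - A y.
Proof. by case/linear_fun_ex => L ->; exact: linearB. Qed.

Lemma linD A x y : linear A -> A (x + y) = A x + A y.
Proof. by case/linear_fun_ex => L ->; exact: linearD. Qed.

Lemma linZ A a x : linear A -> A (a *: x) = a *: A x.
Proof. by case/linear_fun_ex => L ->; exact: linearZ. Qed.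

Lemma lin_sum A I (s : seq I) (P : pred I) (f : I -> H) : linear A ->
  A (\sum_(i <- s | P i) f i) = \sum_(i <- s | P i) A (f i).
Proof. by case/linear_fun_ex => L ->; exact: linear_sum. Qed.

Lemma linear_id : linear (id : H -> H).
Proof. by []. Qed.

Lemma linear_addop A B : linear A -> linear B -> linear (A + B).
Proof. by move=> hA hB a x y; rewrite /GRing.add/= hA hB scalerDr addrACA. Qed.

Lemma linear_subop A B : linear A -> linear B -> linear (A - B).
Proof.
move=> hA hB a x y.
by rewrite !fctE hA hB scalerBr opprD addrACA.
Qed.

Lemma bounded_operator_hnorm A : bounded_operator A ->
  exists M : R, 0 < M /\ forall x, hnorm (A x) <= M * hnorm x.
Proof.
move=> [/linear_fun_ex [L ->] cL].
have /linear_boundedP /pinfty_ex_gt0 [r r0 Lr] := continuous_linear_bounded 0 (cL 0).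
exists (complex.Re r); split.
  by move: r0; rewrite ltcE => /andP[].
move=> x; have rE : r = (complex.Re r)%:C by rewrite RRe_real// gtr0_real.
by rewrite -lecR rmorphM/= -rE -!hnormE.
Qed.

Section Positive.
Variables (A : H -> H).
Hypotheses (linA : linear A) (posA : positive_operator A).

Lemma positive_inner_re x : inner (A x) x = (re_inner (A x) x)%:C.
Proof. by rewrite /re_inner RRe_real// ger0_real. Qed.

Lemma positive_re_ge0 x : 0 <= re_inner (A x) x.
Proof. by rewrite -ler0c -positive_inner_re. Qed.

(** Polarization: <A z, z> is real for z = x + y and for z = x + i y, which fixes the imaginary and
    the real part respectively. *)
Lemma positive_selfadjoint x y : inner (A x) y = inner x (A y).
Proof.
have im0 z : complex.Im (inner (A z) z) = 0 by rewrite positive_inner_re.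
have := im0 (x + y); rewrite linD// innerDl !innerDr !raddfD/= !im0.
have := im0 (x + 'i *: y).
rewrite linD// linZ// innerDl !innerDr !raddfD/= im0 !innerZl !innerZr.
rewrite (innerC (A y) x).
case: (inner (A x) y) => b c; case: (inner (A y) x) => b' c'.
case: (inner (A y) y) (im0 y) => b'' c'' /= -> h1 h2.
by congr Complex; lra.
Qed.

Lemma positive_re_selfadjoint x y : re_inner (A x) y = re_inner x (A y).
Proof. by rewrite /re_inner positive_selfadjoint. Qed.

Lemma positive_CS x y :
  re_inner (A x) y ^+ 2 <= re_inner (A x) x * re_inner (A y) y.
Proof.
have q t : 0 <= re_inner (A x) x + 2 * t * re_inner (A x) y
    + t ^+ 2 * re_inner (A y) y.
  have := positive_re_ge0 (x + t%:C *: y).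
  rewrite linD// linZ// !re_innerDl !re_innerDr !re_innerZl !re_innerZr.
  by rewrite (positive_re_selfadjoint y x) (re_innerC y (A x)); lra.
have [b0|b0] := eqVneq (re_inner (A y) y) 0.
  have [c0|c0] := eqVneq (re_inner (A x) y) 0; first by rewrite b0 c0 mulr0 expr0n.
  (* With <A y, y> = 0 the form q is affine in t, and this t gives it the value -1. *)
  have := q (- (re_inner (A x) x + 1) / (2 * re_inner (A x) y)).
  rewrite b0 mulr0 addr0 mulrAC [2 * _]mulrC -mulrA.
  by rewrite [X in _ + X](_ : _ = - (re_inner (A x) x + 1)) ?[X in 0 <= X]opprD; [lra|field].
have bgt : 0 < re_inner (A y) y by rewrite lt_def b0 positive_re_ge0.
(* The minimizer of the quadratic in t. *)
have := q (- re_inner (A x) y / re_inner (A y) y).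
rewrite -(pmulr_lge0 _ bgt).
rewrite [X in 0 <= X](_ : _ = re_inner (A x) x * re_inner (A y) y - re_inner (A x) y ^+ 2).
  by lra.
by field.
Qed.

End Positive.

Lemma positive_id : positive_operator (id : H -> H).
Proof. by move=> x; rewrite innerE ler0c sqr_ge0. Qed.

Lemma re_inner_CS x y : `|re_inner x y| <= hnorm x * hnorm y.
Proof.
rewrite -ler_sqr ?nnegrE ?mulr_ge0 ?hnorm_ge0//.
rewrite real_normK ?num_real// exprMn -!re_innerE.
exact: (positive_CS linear_id positive_id).
Qed.

Lemma re_inner_le_hnorm x y : re_inner x y <= hnorm x * hnorm y.
Proof. exact: le_trans (ler_norm _) (re_inner_CS x y). Qed.

End LinearMaps.

Lemma gt0_real_complex (R : realType) (e : R[i]) : 0 < e ->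
  exists2 r : R, 0 < r & e = r%:C.
Proof.
move=> e0; have eE : e = (complex.Re e)%:C by rewrite RRe_real// gtr0_real.
by exists (complex.Re e) => //; rewrite -ltcR -eE.
Qed.

Lemma cvg_hnorm (R : realType) (H : hilbertType R) (u : nat -> H) (x : H) :
  u @ \oo --> x <-> hnorm (x - u n) @[n --> \oo] --> (0 : R).
Proof.
split.
- move=> /cvgrPdist_lt ux; apply/cvgr0Pnorm_lt => r r0.
  near=> n; rewrite ger0_norm ?hnorm_ge0// -ltcR -hnormE.
  by near: n; apply: ux; rewrite ltcR.
- move=> /cvgr0Pnorm_lt ux; apply/cvgrPdist_lt => e /gt0_real_complex[r r0 ->].
  near=> n; rewrite hnormE ltcR -[ltLHS]ger0_norm ?hnorm_ge0//.
  by near: n; exact: ux.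
Unshelve. all: by end_near. Qed.

(** * Fourier expansion along an orthonormal basis *)

Section OrthonormalBasis.
Context {R : realType} {H : hilbertType R}.
Variable (e : nat -> H).
Hypothesis (onb : orthonormal_basis e).
Implicit Types (x y : H).

Definition onb_proj N x : H := \sum_(n < N) inner x (e n) *: e n.

(** Absorbs the two cases e n = 0 and |e n| = 1 of the definition of a basis. *)
Lemma onb_coord x n : inner x (e n) * inner (e n) (e n) = inner x (e n).
Proof.
have [_ /(_ n)[->|e1] _] := onb; first by rewrite inner0r mul0r.
by rewrite [X in _ * X]inner_formE e1 expr1n mulr1.
Qed.

Lemma inner_onb_proj N x n : (n < N)%N ->
  inner (onb_proj N x) (e n) = inner x (e n).
Proof.
move=> nN; rewrite inner_suml (bigD1 (Ordinal nN))//= innerZl onb_coord.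
rewrite big1 ?addr0// => m /eqP mn; rewrite innerZl.
have [h _ _] := onb; rewrite h ?mulr0// => mn'.
by case: mn; exact/val_inj.
Qed.

Lemma onb_proj_inner N x y : inner (onb_proj N x) y =
  \sum_(n < N) inner x (e n) * inner (e n) y.
Proof. by rewrite inner_suml; apply: eq_bigr => n _; rewrite innerZl. Qed.

Lemma onb_proj_le M N x y : (M <= N)%N ->
  inner (onb_proj N x) (onb_proj M y) = inner x (onb_proj M y).
Proof.
move=> MN; rewrite !inner_sumr; apply: eq_bigr => n _.
by rewrite !innerZr inner_onb_proj// (leq_trans (ltn_ord n)).
Qed.

Lemma re_onb_proj N x : re_inner (onb_proj N x) x = hnorm (onb_proj N x) ^+ 2.
Proof. by rewrite -re_innerE re_innerC /re_inner onb_proj_le. Qed.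

Lemma onb_proj_pythagoras M N x : (M <= N)%N ->
  hnorm (onb_proj N x - onb_proj M x) ^+ 2 =
  hnorm (onb_proj N x) ^+ 2 - hnorm (onb_proj M x) ^+ 2.
Proof.
move=> MN; have NM : re_inner (onb_proj N x) (onb_proj M x) = hnorm (onb_proj M x) ^+ 2.
  by rewrite /re_inner onb_proj_le// -/(re_inner _ _) re_innerC re_onb_proj.
rewrite -re_innerE re_innerBl !re_innerBr (re_innerC (onb_proj M x)) !NM.
by rewrite !re_innerE; ring.
Qed.

Lemma hnorm_sub_onb_proj N x :
  hnorm (x - onb_proj N x) ^+ 2 = hnorm x ^+ 2 - hnorm (onb_proj N x) ^+ 2.
Proof.
rewrite -re_innerE re_innerBl !re_innerBr (re_innerC x) re_onb_proj !re_innerE.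
by ring.
Qed.

Lemma onb_proj_bessel N x : hnorm (onb_proj N x) ^+ 2 <= hnorm x ^+ 2.
Proof. by rewrite -subr_ge0 -hnorm_sub_onb_proj sqr_ge0. Qed.

(** By Pythagoras and Bessel the squared norms of the projections converge and control their mutual
    distances, so the projections are Cauchy. Their limit has the coordinates of x, hence equals x
    because the basis is total. *)
Lemma onb_proj_cvg x : onb_proj ^~ x @ \oo --> x.
Proof.
set s := fun N => hnorm (onb_proj N x) ^+ 2.
have s_cvg : cvgn s.
  apply: nondecreasing_is_cvgn.
    move=> M N MN; rewrite -subr_ge0 /s -onb_proj_pythagoras//.
    exact: sqr_ge0.
  by exists (hnorm x ^+ 2) => _ [N _ <-]; exact: onb_proj_bessel.
have diff_s M N : hnorm (onb_proj M x - onb_proj N x) ^+ 2 = `|s M - s N|.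
  wlog MN : M N / (M <= N)%N => [hw|].
    have [/hw//|/ltnW/hw hNM] := leqP M N.
    by rewrite hnorm_distC distrC.
  rewrite hnorm_distC distrC onb_proj_pythagoras// ger0_norm//.
  by rewrite -onb_proj_pythagoras// sqr_ge0.
have : cvg (onb_proj ^~ x @ \oo).
  apply: cauchy_cvg; apply: cauchy_exP => /= _ /gt0_real_complex[r r0 ->].
  have r2 : 0 < r ^+ 2 / 2 by rewrite divr_gt0 ?exprn_gt0.
  have /cvgrPdist_lt/(_ _ r2)[M _ sM] := s_cvg.
  exists (onb_proj M x); exists M => // N MN /=; rewrite -ball_normE.
  rewrite /= hnormE ltcR -(@ltr_pXn2r _ 2) ?nnegrE ?hnorm_ge0 ?ltW// diff_s.
  rewrite (splitr (r ^+ 2)) (le_lt_trans (ler_distD (limn s) _ _))//.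
  apply: ltrD; last by apply: sM.
  by rewrite distrC; apply: sM => /=.
move=> /cvg_ex[y xy]; suff yx : y = x by rewrite -[X in _ --> X]yx.
apply/eqP; rewrite -subr_eq0; apply/eqP; have [_ _] := onb; apply => n.
have yx0 : hnorm (y - onb_proj N x) @[N --> \oo] --> (0 : R) by apply/cvg_hnorm.
(* Coordinate n of the projection no longer changes once N > n; the scalar c is later 1 and i, to
   reach both parts of the inner product. *)
have eqz (c : R[i]) N : (n < N)%N ->
    inner (y - x) (c *: e n) = inner (y - onb_proj N x) (c *: e n).
  by move=> nN; rewrite !innerBl !innerZr inner_onb_proj.
have re0 (c : R[i]) : re_inner (y - x) (c *: e n) = 0.
  apply/eqP; rewrite -normr_le0.
  apply: (cvgr_to_ge (f := fun N => hnorm (y - onb_proj N x) * hnorm (c *: e n))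
      (F := \oo)).
    by rewrite -[X in _ --> X](mul0r (hnorm (c *: e n))); apply: cvgMl.
  by exists n.+1 => // N /= nN; rewrite /re_inner (eqz _ _ nN) re_inner_CS.
have := re0 1; have := re0 'i; rewrite -Im_inner scale1r /re_inner.
by case: (inner _ _) => a b /= -> ->.
Qed.
Lemma cvg_hnorm_onb_proj x :
  hnorm (onb_proj N x) ^+ 2 @[N --> \oo] --> hnorm x ^+ 2.
Proof.
have -> : (fun N => hnorm (onb_proj N x) ^+ 2) =
    (fun N => hnorm x ^+ 2 - hnorm (x - onb_proj N x) ^+ 2).
  by apply/funext => N; rewrite hnorm_sub_onb_proj; ring.
rewrite -[X in _ --> X]subr0; apply: cvgB; first exact: cvg_cst.
have /cvg_hnorm h : onb_proj ^~ x @ \oo --> x by exact: onb_proj_cvg.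
by rewrite -(mulr0 0); exact: cvgM.
Qed.

End OrthonormalBasis.

(** * Cholesky decomposition of a positive operator *)

Section Cholesky.
Context {R : realType} {H : hilbertType R}.
Implicit Types (s A : H -> H) (x y : H).

(* With v = chol_vector s x this is s - |v><v|; in the form s (y - c x), where
   <s (y - c x), x> = 0, it is visibly positive.  If <s x, x> = 0 then s x = 0
   and the inverses with value 0 make the step trivial. *)
Definition chol_step s x y : H :=
  s (y - ((re_inner (s x) x)^-1%:C * inner (s y) x) *: x).

Definition chol_vector s x : H :=
  (Num.sqrt (re_inner (s x) x))^-1%:C *: s x.

Section Step.
Variables (s : H -> H) (x : H).
Hypotheses (lin_s : linear s) (pos_s : positive_operator s).

Lemma chol_stepE y :
  chol_step s x y = s y - inner y (chol_vector s x) *: chol_vector s x.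
Proof.
rewrite /chol_step (linB _ _ lin_s) (linZ _ _ lin_s) /chol_vector innerZr scalerA.
congr (_ - _ *: _).
rewrite positive_selfadjoint// mulrAC; congr (_ * _).
have conjR (r : R) : Num.conj (r%:C) = r%:C by exact: conjc_real.
by rewrite conjR -rmorphM -invfM -expr2 sqr_sqrtr// positive_re_ge0.
Qed.

Lemma linear_chol_step : linear (chol_step s x).
Proof.
move=> a y z; rewrite !chol_stepE lin_s innerDl innerZl scalerDl opprD.
by rewrite scalerBr -[in LHS]scalerA addrACA.
Qed.

Lemma positive_chol_step : positive_operator (chol_step s x).
Proof.
move=> y; rewrite /chol_step; set c := (_ * _).
suff cx : inner (s (y - c *: x)) x * Num.conj c = 0.
  have := pos_s (y - c *: x); rewrite innerBr.
  by rewrite innerZr mulrC cx subr0.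
rewrite (linB _ _ lin_s) (linZ _ _ lin_s) innerBl innerZl (positive_inner_re pos_s x).
have [a0|a0] := eqVneq (re_inner (s x) x) 0.
  by rewrite {2}/c a0 invr0 rmorph0 mul0r conjC0 mulr0.
rewrite (_ : c * _ = inner (s y) x) ?subrr ?mul0r//.
by rewrite /c mulrAC -rmorphM/= mulVf// mul1r.
Qed.

(** For a nonzero pivot <s x, x> the coefficient is 1 and the argument of s vanishes. For a zero
    pivot, Cauchy-Schwarz between x and s x forces s x = 0. *)
Lemma chol_step_self : chol_step s x x = 0.
Proof.
rewrite /chol_step (positive_inner_re pos_s x) -rmorphM/=.
have [a0|a0] := eqVneq (re_inner (s x) x) 0; last by rewrite mulVf// scale1r subrr lin0.
rewrite a0 mulr0 scale0r subr0; apply/eqP; rewrite -hnorm_eq0 -sqrf_eq0 -re_innerE.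
by rewrite -sqrf_eq0 eq_le sqr_ge0 andbT; have := positive_CS lin_s pos_s x (s x); rewrite a0 mul0r.
Qed.

Lemma chol_step0 y : s y = 0 -> chol_step s x y = 0.
Proof. by move=> sy; rewrite /chol_step sy inner0l mulr0 scale0r subr0. Qed.

End Step.

Variables (e : nat -> H) (s : H -> H).
Hypotheses (onb : orthonormal_basis e).
Hypotheses (lin_s : linear s) (pos_s : positive_operator s).

Fixpoint chol k : H -> H := if k is j.+1 then chol_step (chol j) (e j) else s.

Definition chol_column k : H := chol_vector (chol k) (e k).

Lemma linear_positive_chol k : linear (chol k) /\ positive_operator (chol k).
Proof.
elim: k => [|k [lk pk]] //=.
by split; [exact: linear_chol_step|exact: positive_chol_step].
Qed.

Lemma linear_chol k : linear (chol k).
Proof. by have [] := linear_positive_chol k. Qed.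

Lemma positive_chol k : positive_operator (chol k).
Proof. by have [] := linear_positive_chol k. Qed.

(** Each step kills its own pivot vector and keeps killed what earlier steps killed. *)
Lemma chol_basis0 k n : (n < k)%N -> chol k (e n) = 0.
Proof.
elim: k => // k IHk; rewrite ltnS leq_eqVlt => /orP[/eqP ->|nk] /=.
  by apply: chol_step_self; [exact: linear_chol|exact: positive_chol].
by apply: chol_step0; exact: IHk.
Qed.

Lemma cholE k y :
  chol k y = s y - \sum_(j < k) inner y (chol_column j) *: chol_column j.
Proof.
elim: k => [|k IHk]; first by rewrite big_ord0 subr0.
rewrite /= chol_stepE; [|exact: linear_chol|exact: positive_chol].
by rewrite IHk big_ord_recr/= opprD addrA.
Qed.

Definition partial_trace N : R := \sum_(n < N) re_inner (s (e n)) (e n).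

Lemma nondecreasing_partial_trace : nondecreasing_seq partial_trace.
Proof.
apply/nondecreasing_seqP => N; rewrite /partial_trace big_ord_recr/= lerDl.
exact: positive_re_ge0.
Qed.

(** Both sides are the sum of |<v_k, e_n>|^2 over k < K and n < N: summed over k first, it is what K
    steps remove from the n-th diagonal entry of s. *)
Lemma sum_onb_proj_chol_column K N :
  \sum_(k < K) hnorm (onb_proj e N (chol_column k)) ^+ 2 =
  partial_trace N - \sum_(n < N) re_inner (chol K (e n)) (e n).
Proof.
rewrite -sumrB.
under eq_bigr do rewrite -re_onb_proj// /re_inner onb_proj_inner raddf_sum/=.
rewrite exchange_big/=; apply: eq_bigr => n _.
rewrite cholE re_innerBl opprB addrC subrK /re_inner inner_suml raddf_sum/=.
by apply: eq_bigr => k _; rewrite innerZl mulrC.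
Qed.

Lemma sum_onb_proj_chol_column_diag N :
  \sum_(k < N) hnorm (onb_proj e N (chol_column k)) ^+ 2 = partial_trace N.
Proof.
rewrite sum_onb_proj_chol_column big1 ?subr0// => n _.
by rewrite chol_basis0// /re_inner inner0l.
Qed.

(** Let N go to infinity with K fixed; the remainder after K steps is positive, so dropping its
    diagonal only enlarges the bound. *)
Lemma sum_chol_column_le t K : (forall N, partial_trace N <= t) ->
  \sum_(k < K) hnorm (chol_column k) ^+ 2 <= t.
Proof.
move=> ht.
have cv : \sum_(k < K) hnorm (onb_proj e N (chol_column k)) ^+ 2 @[N --> \oo]
    --> \sum_(k < K) hnorm (chol_column k) ^+ 2.
  elim: (K) => [|k IHk].
    by rewrite big_ord0; under eq_fun do rewrite big_ord0; exact: cvg_cst.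
  rewrite big_ord_recr/=; under eq_fun do rewrite big_ord_recr/=.
  by apply: cvgD => //; exact: cvg_hnorm_onb_proj.
apply: (cvgr_to_le cv); apply: nearW => N.
rewrite sum_onb_proj_chol_column (le_trans _ (ht N))// gerBl sumr_ge0// => n _.
by apply: positive_re_ge0; exact: positive_chol.
Qed.

(* The remainder [chol N] of the decomposition annihilates e_0, ..., e_(N-1). *)
Lemma partial_trace_mul A N : linear A ->
  \sum_(n < N) inner (s (A (e n))) (e n) =
  \sum_(k < N) inner (A (onb_proj e N (chol_column k))) (chol_column k).
Proof.
move=> lA.
under [RHS]eq_bigr do rewrite lin_sum// inner_suml.
rewrite exchange_big/=; apply: eq_bigr => n _.
have : inner (chol N (A (e n))) (e n) = 0.
  rewrite positive_selfadjoint; [|exact: linear_chol|exact: positive_chol].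
  by rewrite chol_basis0// inner0r.
rewrite cholE innerBl => /eqP; rewrite subr_eq0 => /eqP ->.
rewrite inner_suml; apply: eq_bigr => k _.
by rewrite linZ// !innerZl mulrC.
Qed.

End Cholesky.

Lemma cvg_complex (R : realType) (u : nat -> R[i]) (S : R) :
  complex.Re (u n) @[n --> \oo] --> S ->
  complex.Im (u n) @[n --> \oo] --> (0 : R) ->
  (u : nat -> R[i]^o) @ \oo --> (S%:C : R[i]^o).
Proof.
move=> uS u0; apply/cvgrPdist_lt => e /gt0_real_complex[r r0 ->].
have r2 : 0 < r / 2 by rewrite divr_gt0.
move/cvgrPdist_lt : uS => /(_ _ r2) uS; move/cvgrPdist_lt : u0 => /(_ _ r2) u0.
near=> n; rewrite [X in `|X|]complexE (le_lt_trans (ler_normD _ _))// normrM.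
rewrite (_ : `|'i| = 1 :> R[i]) ?mul1r; last first.
  by rewrite normc_def/= expr0n expr1n add0r sqrtr1.
rewrite !normc_def/= !expr0n/= !addr0 !sqrtr_sqr -rmorphD ltcR (splitr r).
rewrite !raddfB/= ltrD//; near: n; [exact: uS|exact: u0].
Unshelve. all: by end_near. Qed.

(** * Convergence of Tr (s A) for positive s and A *)

Section TraceProduct.
Context {R : realType} {H : hilbertType R}.
Variables (e : nat -> H) (s : H -> H) (t0 : R).
Hypotheses (onb : orthonormal_basis e).
Hypotheses (lin_s : linear s) (pos_s : positive_operator s).
Hypothesis (trs : forall N, partial_trace e s N <= t0).

(* With v_k the columns of the decomposition of s, the N-th partial sum is
   sum_(k < N) <A (proj_N v_k), v_k>, and it is compared with the
   nondecreasing bounded sequence a N = sum_(k < N) <A v_k, v_k>. *)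
Lemma trace_product_cvg (A : H -> H) : bounded_operator A -> positive_operator A ->
  exists2 S : R, 0 <= S &
    series (fun n => inner (s (A (e n))) (e n) : R[i]^o) @ \oo --> (S%:C : R[i]^o).
Proof.
move=> bA pA; have [M [M0 AM]] := bounded_operator_hnorm bA.
have lA : linear A by case: bA.
pose v := chol_column e s.
have tr_cvg : cvgn (partial_trace e s).
  apply: nondecreasing_is_cvgn; first exact: nondecreasing_partial_trace.
  by exists t0 => _ [N _ <-].
set t := limn (partial_trace e s) in tr_cvg.
have tr_le N : partial_trace e s N <= t.
  exact: (nondecreasing_cvgn_le (nondecreasing_partial_trace _ _)).
have v_le K : \sum_(k < K) hnorm (v k) ^+ 2 <= t by exact: sum_chol_column_le.
have t_ge0 : 0 <= t by have := v_le 0; rewrite big_ord0.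
pose a N := \sum_(k < N) re_inner (A (v k)) (v k).
have a_ge0 N : 0 <= a N by apply: sumr_ge0 => k _; exact: positive_re_ge0.
have nd_a : nondecreasing_seq a.
  by apply/nondecreasing_seqP => N; rewrite /a big_ord_recr/= lerDl positive_re_ge0.
have cvg_a : cvgn a.
  apply: nondecreasing_is_cvgn => //; exists (M * t) => _ [N _ <-].
  apply: (@le_trans _ _ (M * \sum_(k < N) hnorm (v k) ^+ 2)); last by rewrite ler_pM2l.
  rewrite mulr_sumr ler_sum// => k _; rewrite (le_trans (re_inner_le_hnorm _ _))//.
  by rewrite expr2 mulrA ler_wpM2r ?hnorm_ge0.
exists (limn a); first by apply: limr_ge => //; exact: nearW.
pose d N := \sum_(k < N) hnorm (onb_proj e N (v k) - v k) * hnorm (v k).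
have d_ge0 N : 0 <= d N by apply: sumr_ge0 => k _; rewrite mulr_ge0 ?hnorm_ge0.
(* Uses 2 eps a b <= a^2 + eps^2 b^2 termwise. The squared projection errors sum to sum_(k < N)
   |v_k|^2 - [partial_trace e s N], at most eps^2, and the other terms to at most eps^2 t. *)
have d_le N (eps : R) : 0 < eps -> t - partial_trace e s N <= eps ^+ 2 ->
    d N <= eps * (1 + t) / 2.
  move=> eps0 tN.
  rewrite -(ler_pM2l (mulr_gt0 (ltr0n R 2) eps0)).
  apply: (@le_trans _ _ (\sum_(k < N) (hnorm (v k - onb_proj e N (v k)) ^+ 2
      + eps ^+ 2 * hnorm (v k) ^+ 2))).
    rewrite mulr_sumr ler_sum// => k _; rewrite hnorm_distC.
    have := sqr_ge0 (hnorm (v k - onb_proj e N (v k)) - eps * hnorm (v k)).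
    by lra.
  rewrite big_split/= -mulr_sumr.
  under eq_bigr do rewrite hnorm_sub_onb_proj//.
  rewrite sumrB sum_onb_proj_chol_column_diag//.
  have := v_le N; move: (\sum_(k < N) _) => V Vt.
  have : eps ^+ 2 * V <= eps ^+ 2 * t by rewrite ler_pM2l ?exprn_gt0.
  by lra.
have d_cvg : d @ \oo --> (0 : R).
  apply/cvgr0Pnorm_lt => r r0; have t1 : 0 < 1 + t by lra.
  pose eps := r / (1 + t); have eps0 : 0 < eps by rewrite divr_gt0.
  move/cvgrPdist_lt : tr_cvg => /(_ _ (exprn_gt0 2 eps0)) tr_near.
  near=> N; rewrite ger0_norm//; apply: (@le_lt_trans _ _ (eps * (1 + t) / 2)).
    apply: d_le => //; apply: ltW; apply: le_lt_trans (ler_norm _) _.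
    by near: N; exact: tr_near.
  by rewrite /eps mulfVK ?gt_eqF//; lra.
(* c = 1 serves the real parts and c = i the imaginary parts, where <A v_k, v_k> contributes
   nothing. *)
have d_bound N (c : R[i]) : (forall x, hnorm (c *: x : H) = hnorm x) ->
    `|\sum_(k < N) re_inner (A (onb_proj e N (v k) - v k)) (c *: v k)| <= M * d N.
  move=> hc; rewrite mulr_sumr (le_trans (ler_norm_sum _ _ _))// ler_sum// => k _.
  by rewrite (le_trans (re_inner_CS _ _))// hc mulrA ler_wpM2r ?hnorm_ge0.
have Md : M * d N @[N --> \oo] --> (0 : R).
  by rewrite -(mulr0 M); apply: cvgM => //; exact: cvg_cst.
have u_re N : `|complex.Re (\sum_(n < N) inner (s (A (e n))) (e n)) - a N| <= M * d N.
  rewrite (partial_trace_mul e lin_s pos_s N lA) raddf_sum -sumrB.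
  rewrite (eq_bigr (fun k : 'I_N =>
      re_inner (A (onb_proj e N (v k) - v k)) (1 *: v k))).
    by apply: d_bound => x; rewrite scale1r.
  by move=> k _; rewrite linB// re_innerBl scale1r.
have u_im N : `|complex.Im (\sum_(n < N) inner (s (A (e n))) (e n))| <= M * d N.
  rewrite (partial_trace_mul e lin_s pos_s N lA) raddf_sum/=.
  rewrite (eq_bigr (fun k : 'I_N =>
      re_inner (A (onb_proj e N (v k) - v k)) ('i *: v k))).
    by apply: d_bound => x; exact: hnormi.
  move=> k _; rewrite linB// re_innerBl -!Im_inner.
  by rewrite (positive_inner_re pA (v k)) subr0.
have to0 (w : nat -> R) : (forall N, `|w N| <= M * d N) -> w @ \oo --> (0 : R).
  move=> wd; apply: norm_cvg0; apply: (squeeze_cvgr _ (cvg_cst 0) Md).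
  by apply: nearW => N; rewrite normr_ge0 wd.
apply: cvg_complex; rewrite seriesEord/=; last exact: to0.
by apply: (cvg_sub0 _ cvg_a); apply: to0 => N; exact: u_re.
Unshelve. all: by end_near. Qed.

End TraceProduct.

(** * Absolute value and trace norm *)

Section AbsoluteValue.
Context {R : realType} {H : hilbertType R}.
Implicit Types (A P T s : H -> H) (x y : H).

(** The real inequality with x replaced by c^* x, where c = <A x, y>, reads |c|^4 <= |c|^2 <A x, x>
    <A y, y>; then cancel |c|^2. *)
Lemma positive_CS_complex A x y : linear A -> positive_operator A ->
  complex.Re (inner (A x) y * inner y (A x)) <=
  re_inner (A x) x * re_inner (A y) y.
Proof.
move=> lA pA; rewrite (innerC (A x) y); set c := inner (A x) y.
set r := complex.Re (c * c^*).
have r_ge0 : 0 <= c * c^* by exact: mul_conjC_ge0.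
have rE : c * c^* = r%:C by rewrite /r RRe_real// ger0_real.
have r0 : 0 <= r by rewrite -ler0c -rE.
have := positive_CS lA pA (c^* *: x) y.
rewrite linZ// /re_inner !innerZl innerZr -/c (mulrC _ c) conjCK mulrA (mulrC _ c).
rewrite rE positive_inner_re// -rmorphM/=.
move: r0; rewrite le_eqVlt => /orP[/eqP <- _|r0].
  by rewrite mulr_ge0 ?positive_re_ge0.
by rewrite expr2 -mulrA ler_pM2l.
Qed.

Lemma partial_trace_le_positive_trace P N : positive_operator P ->
  ((partial_trace std_basis P N)%:E <= positive_trace P)%E.
Proof.
move=> pP; rewrite /partial_trace /positive_trace -(big_mkord xpredT
  (fun n => re_inner (P (std_basis n)) (std_basis n))) -sumEFin.
by apply: nneseries_lim_ge => n _ _; rewrite lee_fin positive_re_ge0.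
Qed.

Lemma positive_trace_ge0 P : positive_operator P -> (0 <= positive_trace P)%E.
Proof.
move=> /(partial_trace_le_positive_trace 0); apply: le_trans.
by rewrite /partial_trace big_ord0.
Qed.

Lemma hnorm_abs_operator T P x : is_abs_operator T P -> hnorm (T x) = hnorm (P x).
Proof.
move=> [[lP _] pP [B TB PB]].
apply/eqP; rewrite -(@eqrXn2 _ 2) ?hnorm_ge0// -!re_innerE /re_inner.
rewrite TB (_ : B (T x) = P (P x)); last by have := congr1 (@^~ x) PB.
by rewrite positive_selfadjoint.
Qed.

(* Let lam >= 0 be least with E := s - P <= lam, and put Q := lam - E >= 0 and
   S := s + P.  As Re <E x, S x> = 0, lam <S x, x> = Re <Q x, S x>, and the
   Cauchy-Schwarz inequality for Q gives lam^3 |x|^2 <= D <Q x, x> with D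
   constant, hence E <= lam - lam^3 / D: so lam = 0. *)
Lemma abs_operator_le s P : bounded_operator s -> positive_operator s ->
    bounded_operator P -> positive_operator P ->
    (forall x, hnorm (s x) = hnorm (P x)) ->
  forall x, re_inner (s x) x <= re_inner (P x) x.
Proof.
move=> bs ps bP pP sP.
have [ls _] := bs; have [lP _] := bP.
have [Ms [Ms0 sM]] := bounded_operator_hnorm bs.
have [Mp [Mp0 PM]] := bounded_operator_hnorm bP.
have bd A M y : (forall x, hnorm (A x) <= M * hnorm x) ->
    re_inner (A y) y <= M * hnorm y ^+ 2.
  move=> AM; rewrite (le_trans (re_inner_le_hnorm _ _))// expr2 mulrA.
  by rewrite ler_wpM2r ?hnorm_ge0.
pose E x := re_inner (s x) x - re_inner (P x) x.
pose L := [set l : R | 0 <= l /\ forall x, E x <= l * hnorm x ^+ 2].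
have L0 : L Ms.
  split; first exact: ltW.
  by move=> x; have := bd s Ms x sM; have := positive_re_ge0 pP x; rewrite /E; lra.
have hL : has_inf L by split; [exists Ms|exists 0 => l []].
set lam := inf L.
have lam_ge0 : 0 <= lam by apply: lb_le_inf; [exists Ms|move=> l []].
have Elam x : E x <= lam * hnorm x ^+ 2.
  have [->|x0] := eqVneq x 0; first by rewrite /E !lin0// /re_inner !inner0l hnorm0; lra.
  have hx : 0 < hnorm x ^+ 2 by rewrite exprn_gt0// lt_def hnorm_eq0 x0 hnorm_ge0.
  rewrite -ler_pdivrMr//; apply: lb_le_inf; first by exists Ms.
  by move=> l [_ lE]; rewrite ler_pdivrMr.
suff lam0 : lam = 0 by move=> x; have := Elam x; rewrite lam0 /E mul0r; lra.
apply/eqP; rewrite eq_le lam_ge0 andbT leNgt; apply/negP => lam_gt0.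
pose S := s + P.
have lS : linear S by exact: linear_addop.
have pS : positive_operator S by move=> x; rewrite /S fctE innerDl addr_ge0.
pose Q x := lam%:C *: x - (s x - P x).
have lQ : linear Q.
  have lZ : linear (fun x : H => lam%:C *: x).
    by move=> a x y; rewrite scalerDr !scalerA mulrC.
  exact: linear_subop lZ (linear_subop ls lP).
have QE x y : re_inner (Q x) y =
    lam * re_inner x y - re_inner (s x) y + re_inner (P x) y.
  by rewrite !re_innerBl re_innerZl; ring.
have pQ : positive_operator Q.
  move=> x; rewrite /Q innerBl innerBl innerZl innerE.
  rewrite (positive_inner_re ps x) (positive_inner_re pP x).
  by rewrite -rmorphM -!rmorphB ler0c subr_ge0; exact: Elam.
pose q := lam + Mp; pose K := Ms + Mp.
have Qq y : re_inner (Q y) y <= q * hnorm y ^+ 2.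
  rewrite QE re_innerE; have := positive_re_ge0 ps y; have := bd P Mp y PM.
  by rewrite /q; lra.
(* Cauchy-Schwarz for S between x and S x, with <S (S x), S x> <= K |S x|^2. *)
have SK x : hnorm (S x) ^+ 2 <= K * re_inner (S x) x.
  have := positive_CS lS pS x (S x); rewrite re_innerE.
  have SSK : re_inner (S (S x)) (S x) <= K * hnorm (S x) ^+ 2.
    rewrite (_ : S (S x) = s (S x) + P (S x))// re_innerDl.
    have := bd s Ms (S x) sM; have := bd P Mp (S x) PM.
    by rewrite /K; lra.
  have := positive_re_ge0 pS x; move: (re_inner (S x) x) => u u0.
  have [-> _|hS0] := eqVneq (hnorm (S x) ^+ 2) 0.
    by rewrite mulr_ge0// /K addr_ge0// ltW.
  have hS : 0 < hnorm (S x) ^+ 2 by rewrite lt_def hS0 sqr_ge0.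
  move=> h; rewrite -(ler_pM2r hS) -expr2 (le_trans h)//.
  by rewrite [leRHS]mulrAC [leRHS]mulrC ler_wpM2l.
(* Here |s x| = |P x| enters: the squares cancel, and the cross terms agree by symmetry of
   [re_inner]. *)
have ESx x : re_inner (s x) (S x) = re_inner (P x) (S x).
  rewrite (_ : S x = s x + P x)// !re_innerDr !re_innerE sP (re_innerC (s x)).
  by ring.
have QS x : re_inner (Q x) (S x) = lam * re_inner (S x) x.
  by rewrite QE ESx (re_innerC x); ring.
have q0 : 0 < q by rewrite addr_gt0.
have K0 : 0 < K by rewrite addr_gt0.
have D0 : 0 < lam ^+ 2 + q * K by rewrite addr_gt0 ?exprn_gt0 ?mulr_gt0.
have main x : lam ^+ 3 * hnorm x ^+ 2 <= re_inner (Q x) x * (lam ^+ 2 + q * K).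
  set a := re_inner (Q x) x; have a0 : 0 <= a by exact: positive_re_ge0.
  have u0 := positive_re_ge0 pS x.
  have aE : a = lam * hnorm x ^+ 2 - E x by rewrite /a QE re_innerE /E; ring.
  have uE : E x <= re_inner (S x) x.
    by rewrite (_ : S x = s x + P x)// re_innerDl /E; have := positive_re_ge0 pP x; lra.
  (* With u = <S x, x>: (lam u)^2 = (Re <Q x, S x>)^2 <= a <Q (S x), S x> <= a q |S x|^2 <= a q K u,
     then cancel u. *)
  have lamu : lam ^+ 2 * re_inner (S x) x <= a * (q * K).
    move: u0; rewrite le_eqVlt => /orP[/eqP <-|u0].
      by rewrite mulr0 !mulr_ge0// ltW.
    rewrite -(ler_pM2r u0) -mulrA -expr2 -exprMn -QS.
    rewrite (le_trans (positive_CS lQ pQ _ _))// -/a -mulrA ler_wpM2l//.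
    rewrite (le_trans (Qq _))// -mulrA ler_wpM2l// ltW//.
  have : lam ^+ 2 * E x <= a * (q * K).
    by apply: le_trans lamu; rewrite ler_wpM2l// sqr_ge0.
  have -> : E x = lam * hnorm x ^+ 2 - a by rewrite aE; ring.
  by lra.
(* An admissible bound strictly below the infimum [lam]; it is nonnegative because the denominator
   is at least lam^2. *)
have : L (lam - lam ^+ 3 / (lam ^+ 2 + q * K)).
  split.
    rewrite subr_ge0 ler_pdivrMr// exprS ler_wpM2l// lerDl mulr_ge0// ltW//.
  move=> x; rewrite mulrBl; have := main x; rewrite -ler_pdivrMr//.
  by rewrite QE re_innerE /E mulrAC; lra.
move=> /(ge_inf hL.2); rewrite -/lam lerBrDr gerDl leNgt divr_gt0 ?exprn_gt0//.
Qed.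

Section TraceNormBound.
Hypothesis (onb : orthonormal_basis (std_basis : nat -> H)).

(** Summing |<P x, e_n>|^2 <= <P x, x> <P e_n, e_n> over n gives |P x|^2 <= t |x| |P x|. *)
Lemma hnorm_le_trace P (t : R) x : linear P -> positive_operator P ->
  (forall N, partial_trace std_basis P N <= t) -> hnorm (P x) <= t * hnorm x.
Proof.
move=> lP pP Pt; have t0 : 0 <= t by have := Pt 0; rewrite /partial_trace big_ord0.
suff le2 : hnorm (P x) ^+ 2 <= t * hnorm x * hnorm (P x).
  have [->|hP] := eqVneq (hnorm (P x)) 0; first by rewrite mulr_ge0 ?hnorm_ge0.
  by rewrite -(@ler_pM2r _ (hnorm (P x))) -?expr2// lt_def hP hnorm_ge0.
have cv : hnorm (onb_proj std_basis N (P x)) ^+ 2 @[N --> \oo] --> hnorm (P x) ^+ 2.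
  exact: cvg_hnorm_onb_proj.
apply: (cvgr_to_le cv); apply: nearW => N.
rewrite -re_onb_proj// /re_inner onb_proj_inner raddf_sum/=.
apply: (@le_trans _ _ (re_inner (P x) x * partial_trace std_basis P N)).
  rewrite /partial_trace mulr_sumr ler_sum// => n _; exact: positive_CS_complex.
rewrite mulrC -mulrA ler_pM ?positive_re_ge0//.
  by apply: sumr_ge0 => n _; exact: positive_re_ge0.
by rewrite mulrC re_inner_le_hnorm.
Qed.

(** Every admissible P satisfies |T x| = |P x| <= Tr P |x|; then take the infimum over P. As the
    trace norm may be +oo, zero vectors are split off first and rely on 0 * +oo = 0. *)
Lemma re_inner_le_trace_norm T x y : T 0 = 0 ->
  ((re_inner (T x) y)%:E <= (hnorm x * hnorm y)%:E * trace_norm T)%E.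
Proof.
move=> T0; have [->|x0] := eqVneq x 0.
  by rewrite T0 /re_inner inner0l hnorm0 mul0r mul0e.
have [->|y0] := eqVneq y 0; first by rewrite /re_inner inner0r hnorm0 mulr0 mul0e.
have xy0 : 0 < hnorm x * hnorm y.
  by rewrite mulr_gt0// lt_def hnorm_eq0 ?x0 ?y0 hnorm_ge0.
rewrite -lee_pdivrMl//; apply: le_ereal_inf_tmp => _ [P TP <-].
have [[lP _] pP _] := TP.
have PN N := partial_trace_le_positive_trace N pP.
have [p|p] := ltP (positive_trace P) +oo%E; last by rewrite (le_trans _ p)// leey.
have pfin : positive_trace P \is a fin_num.
  by rewrite ge0_fin_numE// positive_trace_ge0.
have Pt N : partial_trace std_basis P N <= fine (positive_trace P).
  by rewrite -lee_fin fineK.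
rewrite -(fineK pfin) -EFinM lee_fin ler_pdivrMl//.
rewrite (le_trans (re_inner_le_hnorm _ _))// mulrAC ler_wpM2r ?hnorm_ge0//.
by rewrite (hnorm_abs_operator _ TP) mulrC; exact: hnorm_le_trace.
Qed.

Lemma trace_class_partial_trace_bound s : trace_class s -> positive_operator s ->
  exists t : R, forall N, partial_trace std_basis s N <= t.
Proof.
move=> [bs sfin] ps.
have [_ [P sP <-] Pfin] : exists2 p, [set positive_trace P | P in is_abs_operator s] p
    & (p < +oo)%E by exact: ereal_inf_lt.
have [bP pP _] := sP.
exists (fine (positive_trace P)) => N; rewrite -lee_fin fineK; last first.
  by rewrite ge0_fin_numE// positive_trace_ge0.
apply: le_trans (partial_trace_le_positive_trace N pP).
rewrite lee_fin ler_sum// => n _; apply: abs_operator_le => // x.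
exact: hnorm_abs_operator.
Qed.

End TraceNormBound.

End AbsoluteValue.

(** * Positivity of Bochner integrals *)

Section BochnerPositivity.
Context {R : realType} {H : hilbertType R}.

Lemma integral_simple_real d (T : measurableType d) (mu : probability T R)
    (I : eqType) (s : seq I) (E : I -> set T) (a : I -> R) :
  (forall i, i \in s -> measurable (E i)) ->
  mu.-integrable setT (fun x => (\sum_(i <- s) \1_(E i) x * a i)%:E) /\
  (\int[mu]_x (\sum_(i <- s) \1_(E i) x * a i)%:E =
   (\sum_(i <- s) fine (mu (E i)) * a i)%:E)%E.
Proof.
elim: s => [|i s IHs] mE.
  have -> : (fun x : T => (\sum_(i <- [::]) \1_(E i) x * a i)%:E) = cst 0%E.
    by apply/funext => x; rewrite big_nil.
  by rewrite big_nil integral0; split => //; exact: integrable0.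
have mEi : measurable (E i) by apply: mE; rewrite mem_head.
have [|IHi IHe] := IHs; first by move=> j js; apply: mE; rewrite inE js orbT.
have indi : mu.-integrable setT (fun x => (\1_(E i) x)%:E).
  exact: integrable_indic.
have -> : (fun x : T => (\sum_(j <- i :: s) \1_(E j) x * a j)%:E) =
    (fun x => (a i)%:E * (\1_(E i) x)%:E + (\sum_(j <- s) \1_(E j) x * a j)%:E)%E.
  by apply/funext => x; rewrite big_cons EFinD EFinM muleC.
have i1 := integrableZl measurableT (a i) indi.
split; first exact: integrableD.
rewrite integralD// IHe big_cons EFinD integralZl// integral_indic// setIT.
by rewrite muleC EFinM fineK// fin_num_measure.
Qed.

Lemma trace_norm_ge0 (A : H -> H) : (0 <= trace_norm A)%E.
Proof. by apply: le_ereal_inf_tmp => _ [P [_ pP _] <-]; exact: positive_trace_ge0. Qed.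

Hypothesis (onb : orthonormal_basis (std_basis : nat -> H)).
Context {d : measure_display} {T : measurableType d}.
Variables (mu : probability T R) (f : T -> H -> H) (A : H -> H).
Hypothesis (fA : is_bochner_integral mu f A).

(** The functional L B = Re <B v, y> commutes with the integral of simple functions and is bounded
    by |v| |y| times the trace norm, so both approximation errors vanish in the limit. A free y,
    rather than y = v, lets the imaginary part be treated by y = i v and y = - i v. *)
Lemma bochner_integral_re_ge0 (v y : H) :
  (forall x, 0 <= re_inner (f x v) y) -> 0 <= re_inner (A v) y.
Proof.
move=> f_ge0; have [tf [[[lA _] _] [s [simple_s meas_s cvg_f cvg_A]]]] := fA.
pose L (B : H -> H) := re_inner (B v) y.
pose k := hnorm v * hnorm y.
have LB B C : L (B - C) = L B - L C by rewrite /L !fctE re_innerBl.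
have lf x : linear (f x) by have [[]] := tf x.
have L_sum (a : set T -> R) n :
    L (\sum_(p <- s n) (a p.1)%:C *: p.2) = \sum_(p <- s n) a p.1 * L p.2.
  elim: (s n) => [|p l IHl]; first by rewrite !big_nil /L /re_inner inner0l.
  by rewrite !big_cons -IHl /L !fctE re_innerDl re_innerZl.
have simple0 (a : set T -> R) n : (\sum_(p <- s n) (a p.1)%:C *: p.2) 0 = 0 :> H.
  have := simple_s n; elim: (s n) => [|p l IHl] hs; first by rewrite big_nil.
  rewrite big_cons !fctE IHl ?addr0; last first.
    by move=> q ql; apply: hs; rewrite inE ql orbT.
  have [_ [[lp _] _]] := hs p (mem_head _ _).
  by rewrite lin0// scaler0.
have r_int_eq n :
    mu.-integrable setT (fun x => (L (eval_simple (s n) x))%:E) /\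
    (\int[mu]_x (L (eval_simple (s n) x))%:E = (L (integral_simple mu (s n)))%:E)%E.
  rewrite /integral_simple (L_sum (fine \o mu)).
  have -> : (fun x => (L (eval_simple (s n) x))%:E) =
      (fun x => (\sum_(p <- s n) \1_(p.1) x * L p.2)%:E).
    by apply/funext => x; rewrite /eval_simple (L_sum (fun a => \1_a x)).
  by apply: integral_simple_real => p ps; have [] := simple_s n p ps.
pose tn n x := trace_norm (f x - eval_simple (s n) x).
have tn_ge0 n x : (0 <= tn n x)%E by exact: trace_norm_ge0.
have k_ge0 : (0 <= k%:E)%E by rewrite lee_fin mulr_ge0 ?hnorm_ge0.
have pointwise n x : ((- L (eval_simple (s n) x))%:E <= k%:E * tn n x)%E.
  apply: le_trans (re_inner_le_trace_norm onb v y _); last first.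
    have e0 : eval_simple (s n) x 0 = 0 by exact: (simple0 (fun a => \1_a x)).
    by rewrite (_ : _ 0 = f x 0 - eval_simple (s n) x 0)// e0 lin0// subr0.
  by rewrite lee_fin -/(L _) LB lerBrDr addNr; exact: f_ge0.
(* Only for large n is the integral of [tn n] known to be finite, as monotonicity of the integral
   requires here. *)
have int_bound : \forall n \near \oo,
    ((- L (integral_simple mu (s n)))%:E <= k%:E * \int[mu]_x tn n x)%E.
  have : \forall n \near \oo, (\int[mu]_x tn n x < 1)%E.
    by move: cvg_f => /(_ [set z | (z < 1)%E]); apply; apply: open_nbhs_nbhs; split;
      [exact: open_ereal_lt_ereal|rewrite /= lte01].
  apply: filterS => n tn1.
  have [ri re] := r_int_eq n.
  have tn_int : mu.-integrable setT (tn n).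
    apply/integrableP; split; first exact: meas_s.
    under eq_integral do rewrite gee0_abs//.
    by rewrite (lt_trans tn1)// ltry.
  rewrite EFinN -re -integralN//=; last first.
    by apply: integrable_add_def.
  rewrite -integralZl//; apply: le_integral => //.
  - exact: (integrableN ri).
  - exact: (integrableZl measurableT k tn_int).
have A_bound n : ((L (integral_simple mu (s n)) - L A)%R%:E <=
    k%:E * trace_norm (A - integral_simple mu (s n))%R)%E.
  rewrite -LB -[X in (X%:E <= _)%E]opprK /L.
  have -> : - re_inner ((integral_simple mu (s n) - A) v) y =
      re_inner ((A - integral_simple mu (s n)) v) y.
    by rewrite !fctE !re_innerBl; ring.
  (* Convergence is given for the trace norm of this difference only, so the sign is moved to y. *)
  have -> : - re_inner ((A - integral_simple mu (s n)) v) y =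
      re_inner ((A - integral_simple mu (s n)) v) (- y).
    by rewrite re_innerNr.
  have -> : k = hnorm v * hnorm (- y) by rewrite /k /hnorm normrN.
  apply: re_inner_le_trace_norm => //.
  have i0 : integral_simple mu (s n) 0 = 0 by exact: (simple0 (fine \o mu)).
  by rewrite (_ : _ 0 = A 0 - integral_simple mu (s n) 0)// i0 lin0// subr0.
rewrite -oppr_le0 -lee_fin.
have lim0 : (k%:E * trace_norm (A - integral_simple mu (s n))%R +
    k%:E * \int[mu]_x tn n x)%E @[n --> \oo] --> 0%E.
  rewrite -[X in _ --> X]adde0 -[in X in (X + _)%E](mule0 k%:E) -[in X in (_ + X)%E](mule0 k%:E).
  by apply: cvgeD; [rewrite mule0| exact: cvgeZl| exact: cvgeZl].
apply: (cvge_to_ge lim0); apply: filterS int_bound => n hn.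
have := leeD (A_bound n) hn; rewrite -EFinD; apply: le_trans.
by rewrite lee_fin /L; lra.
Qed.

Lemma bochner_integral_positive :
  (forall x, positive_operator (f x)) -> positive_operator A.
Proof.
move=> fpos v.
have re_ge0 : 0 <= re_inner (A v) v.
  by apply: bochner_integral_re_ge0 => x; exact: positive_re_ge0.
have fi x : re_inner (f x v) ('i *: v) = 0.
  by rewrite -Im_inner positive_inner_re.
have im_ge0 : 0 <= re_inner (A v) ('i *: v).
  by apply: bochner_integral_re_ge0 => x; rewrite fi.
have im_le0 : 0 <= re_inner (A v) (- ('i *: v)).
  by apply: bochner_integral_re_ge0 => x; rewrite re_innerNr fi oppr0.
have im0 : complex.Im (inner (A v) v) = 0.
  apply/eqP; rewrite Im_inner eq_le im_ge0 andbT.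
  by move: im_le0; rewrite re_innerNr oppr_ge0.
by rewrite lecE/= im0 eqxx.
Qed.

End BochnerPositivity.

(** * Nonnegativity and additivity of A |-> Tr (s A) *)

Section BoundedOperators.
Context {R : realType} {H : hilbertType R}.
Implicit Types (A B s : H -> H).

Lemma zero_opE x : (0 : H -> H) x = 0.
Proof. by []. Qed.

Lemma bounded_operator0 : bounded_operator (0 : H -> H).
Proof.
split; last by move=> x; exact: cvg_cst.
by move=> a x y; rewrite !zero_opE scaler0 addr0.
Qed.

Lemma bounded_operatorD A B :
  bounded_operator A -> bounded_operator B -> bounded_operator (A + B).
Proof.
move=> [lA cA] [lB cB]; split; first exact: linear_addop.
by move=> x; apply: cvgD; [exact: cA|exact: cB].
Qed.

Lemma bounded_operator_sum I (r : seq I) (A : I -> H -> H) :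
  (forall i, bounded_operator (A i)) -> bounded_operator (\sum_(i <- r) A i).
Proof.
move=> bA; elim: r => [|i r IHr]; first by rewrite big_nil; exact: bounded_operator0.
by rewrite big_cons; exact: bounded_operatorD.
Qed.

Lemma positive_operator0 : positive_operator (0 : H -> H).
Proof. by move=> x; rewrite zero_opE inner0l. Qed.

Lemma positive_operatorD A B :
  positive_operator A -> positive_operator B -> positive_operator (A + B).
Proof. by move=> pA pB x; rewrite fctE innerDl addr_ge0. Qed.

Lemma positive_operator_sum I (r : seq I) (A : I -> H -> H) :
  (forall i, positive_operator (A i)) -> positive_operator (\sum_(i <- r) A i).
Proof.
move=> pA; elim: r => [|i r IHr]; first by rewrite big_nil; exact: positive_operator0.
by rewrite big_cons; exact: positive_operatorD.
Qed.

Lemma trace_class0 : trace_class (0 : H -> H).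
Proof.
split; first exact: bounded_operator0.
have abs0 : is_abs_operator 0 (0 : H -> H).
  split; [exact: bounded_operator0|exact: positive_operator0|].
  by exists 0 => // x y; rewrite !zero_opE inner0l inner0r.
apply: (@le_lt_trans _ _ 0%E); last exact: ltry.
apply: ereal_inf_lbound; exists 0 => //; rewrite /positive_trace.
by rewrite eseries0// => n _ _; rewrite zero_opE inner0l.
Qed.

(* Without an orthonormal basis, [std_basis] has its default value [fun=> 0]. *)
Lemma trace_eq0_no_onb A :
  ~ orthonormal_basis (std_basis : nat -> H) -> trace A = 0.
Proof.
move=> nonb; have e0 : std_basis = (fun=> 0 : H).
  by apply: xgetPN => e onb; apply: nonb; rewrite /std_basis; exact: (xgetPex _ (ex_intro _ e onb)).
rewrite /trace e0 (_ : series _ = cst 0) ?lim_cst//.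
by apply/funext => n; rewrite /series/= big1// => k _; rewrite inner0r.
Qed.

Section TraceProduct.
Variable (s : H -> H).
Hypotheses (tr_s : trace_class s) (pos_s : positive_operator s).

Lemma trace_product_cvg_trace A : orthonormal_basis (std_basis : nat -> H) ->
    bounded_operator A -> positive_operator A ->
  0 <= trace (s \o A) /\
  series (fun n => inner ((s \o A) (std_basis n)) (std_basis n) : R[i]^o) @ \oo
    --> (trace (s \o A) : R[i]^o).
Proof.
move=> onb bA pA; have [t st] := trace_class_partial_trace_bound tr_s pos_s.
have [[lin_s _] _] := tr_s.
have [S S0 cvS] := trace_product_cvg onb lin_s pos_s st bA pA.
have -> : trace (s \o A) = S%:C by rewrite /trace; apply: (cvg_lim _ cvS); exact: norm_hausdorff.
by rewrite ler0c.
Qed.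

Lemma trace_product_ge0 A : bounded_operator A -> positive_operator A ->
  0 <= trace (s \o A).
Proof.
move=> bA pA; have [onb|nonb] := pselect (orthonormal_basis (std_basis : nat -> H)).
  by have [] := trace_product_cvg_trace onb bA pA.
by rewrite trace_eq0_no_onb.
Qed.

(** Positivity of A and B makes both series converge, without which the limits need not add up. *)
Lemma trace_productD A B : bounded_operator A -> positive_operator A ->
    bounded_operator B -> positive_operator B ->
  trace (s \o (A + B)) = trace (s \o A) + trace (s \o B).
Proof.
move=> bA pA bB pB.
have [onb|nonb] := pselect (orthonormal_basis (std_basis : nat -> H)); last first.
  by rewrite !trace_eq0_no_onb// addr0.
have [_ cA] := trace_product_cvg_trace onb bA pA.
have [_ cB] := trace_product_cvg_trace onb bB pB.
have [[lin_s _] _] := tr_s.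
suff cv : series (fun n => inner ((s \o (A + B)) (std_basis n)) (std_basis n) : R[i]^o)
    @ \oo --> (trace (s \o A) + trace (s \o B) : R[i]^o).
  by rewrite {1}/trace; apply: (cvg_lim _ cv); exact: norm_hausdorff.
have cAB := cvgD (V := R[i]^o) cA cB.
refine (cvg_trans _ (cAB _)); apply: near_eq_cvg; apply: nearW => n.
rewrite fctE /series/= -big_split/=; apply: eq_bigr => k _.
by rewrite -innerDl -linD.
Qed.

Lemma trace_product0 : trace (s \o 0) = 0.
Proof.
have [[lin_s _] _] := tr_s; rewrite /trace (_ : series _ = cst 0) ?lim_cst//.
by apply/funext => n; rewrite /series/= big1// => k _; rewrite /= zero_opE lin0// inner0l.
Qed.

Lemma trace_product_sum I (r : seq I) (A : I -> H -> H) :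
    (forall i, bounded_operator (A i)) -> (forall i, positive_operator (A i)) ->
  trace (s \o (\sum_(i <- r) A i)) = \sum_(i <- r) trace (s \o A i).
Proof.
move=> bA pA; elim: r => [|i r IHr]; first by rewrite !big_nil trace_product0.
rewrite !big_cons -IHr trace_productD//; first exact: bounded_operator_sum.
exact: positive_operator_sum.
Qed.

End TraceProduct.

End BoundedOperators.

(** * Orbit-averaged states are positive and trace class *)

Section OrbitAverage.
Context {R : realType} {H : hilbertType R} {G : topologicalGroupType}.

Lemma positive_unitary_conj (u s : H -> H) : unitary_operator u ->
  positive_operator s -> positive_operator (u \o s \o adjoint u).
Proof.
move=> [bu au ua] ps x; have [[B uB]|noadj] := pselect (exists B, is_adjoint u B).
  have adj : is_adjoint u (adjoint u) by exact: (xgetPex 0 (ex_intro _ B uB)).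
  by rewrite /= adj; exact: ps.
(* Without an adjoint, [adjoint u] is the default 0, and its composition with u being the identity
   makes H trivial. *)
have -> : x = 0.
  have a0 : adjoint u = 0 by apply: xgetPN => B uB; apply: noadj; exists B.
  by have := congr1 (@^~ x) au; rewrite /= a0 zero_opE.
by rewrite inner0r.
Qed.

(** The average is either a Bochner integral of positive operators, for some representative of the
    orbit, or the default 0; both have the two properties. *)
Lemma orbit_average_trace_class_positive {Theta : Type}
    (mu : probability (borel G) R) (act : G -> Theta -> Theta)
    (U : G -> H -> H) (rho : Theta -> H -> H) (eta : orbit_space act) :
  orthonormal_basis (std_basis : nat -> H) ->
  (forall g, unitary_operator (U g)) -> (forall t, positive_operator (rho t)) ->
  trace_class (orbit_average mu U rho eta) /\
  positive_operator (orbit_average mu U rho eta).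
Proof.
move=> onb unitU pos_rho; rewrite /orbit_average; case: xgetP => [A _ hA|_]; last first.
  by split; [exact: trace_class0|exact: positive_operator0].
have [t ht] := svalP eta; have hAt := hA t ht.
split; first by case: hAt => _ [].
apply: (bochner_integral_positive onb hAt) => g; exact: positive_unitary_conj.
Qed.

End OrbitAverage.

(** * The two-point outcome space is standard Borel *)

Lemma bool_cauchy_cvg (F : set_system bool) : ProperFilter F -> cauchy F -> cvg F.
Proof.
move=> PF cF; have diag_ent : entourage (@diagonal bool).
  by rewrite uniform_discrete => _ [x _ <-].
have [[P Q] /= [FP FQ] PQ] := cF _ diag_ent.
have [b Qb] := filter_ex FQ; apply/cvg_ex; exists b => V bV.
apply: filterS FP => x Px; have xb : x = b := PQ (x, b) (conj Px Qb).
rewrite xb; exact: nbhs_singleton bV.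
Qed.

HB.instance Definition _ := Uniform_isComplete.Build bool bool_cauchy_cvg.

Lemma standard_borel_bool (R : realType) : standard_borel R bool.
Proof.
exists (bool : completePseudoMetricType R), id; split.
- exact: discrete_hausdorff.
- exists setT; split; first exact: countableP.
  by rewrite /dense => O O0 _; rewrite setIT.
- by exists id.
- move=> B; rewrite image_id; split=> // _.
  by apply: sub_sigma_algebra; exact: discrete_open.
Qed.

Section DiscreteMeasure.
Context {R : realType} {d : measure_display} {Z : measurableType d}.

(** [outcome_law] is a bare set function; recognizing it as such a measure is what allows the
    integral in the sufficiency identity to be computed. *)
Lemma sum_dirac_measure (s : seq Z) (p : Z -> R) : (forall z, 0 <= p z) ->
  exists m : {measure set Z -> \bar R},
    (forall B, m B = (\sum_(z <- s) p z * \1_B z)%:E) /\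
    forall f : Z -> R, measurable_fun setT f -> (forall z, 0 <= f z) ->
      (\int[m]_z (f z)%:E = (\sum_(z <- s) p z * f z)%:E)%E.
Proof.
move=> p0; elim: s => [|z s [m [mE mint]]].
  exists mzero; split=> [B|f mf f0]; first by rewrite big_nil.
  by rewrite big_nil integral_measure_zero.
exists (measure_add (mscale (NngNum (p0 z)) (dirac z)) m); split=> [B|f mf f0].
  by rewrite big_cons EFinD EFinM -mE; exact: measure_addE.
have mf' : measurable_fun setT (EFin \o f) by exact/measurable_EFinP.
have f0' (x : Z) : setT x -> (0 <= (f x)%:E)%E by rewrite lee_fin.
rewrite ge0_integral_measure_add// (mint _ mf f0) ge0_integral_mscale//.
by rewrite integral_dirac// diracT mul1e big_cons EFinD EFinM.
Qed.

End DiscreteMeasure.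

(** * The two-outcome measurement of an effect *)

Section EffectMeasurement.
Context {R : realType} {H : hilbertType R}.

(** Indicator weights reduce countable additivity to two scalar series. *)
Definition effect_measurement (E : H -> H) (B : set bool) : H -> H :=
  fun x => (\1_B true : R)%:C *: E x + (\1_B false : R)%:C *: (x - E x).

(** By disjointness at most one F n contains t, so the partial sums are eventually constant. *)
Lemma indic_series_cvg {T : Type} (F : (set T)^nat) (t : T) (c : R[i]) :
  trivIset setT F ->
  (series (fun n => (\1_(F n) t : R)%:C * c) : nat -> R[i]^o) @ \oo -->
    ((\1_(\bigcup_n F n) t : R)%:C * c : R[i]^o).
Proof.
move=> tF; have [[n _ Fnt]|nF] := pselect ((\bigcup_n F n) t).
  apply: cvg_near_cst; exists n.+1 => // N /= nN; rewrite /series/=.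
  rewrite big_mkord (bigD1 (Ordinal nN))//= big1 ?addr0.
    by rewrite !indicE !mem_set//; exists n.
  move=> k /eqP kn; rewrite indicE memNset ?mul0r// => Fkt.
  by apply: kn; apply/val_inj; apply: tF => //; exists t.
apply: cvg_near_cst; apply: nearW => N; rewrite /series/= big1.
  by rewrite indicE memNset ?mul0r.
by move=> k _; rewrite indicE memNset ?mul0r// => Fkt; apply: nF; exists k.
Qed.

Variable (E : H -> H).
Hypotheses (bE : bounded_operator E) (pE : positive_operator E).
Hypothesis (pE' : positive_operator (id - E)).

Lemma effect_measurement_true : effect_measurement E [set true] = E.
Proof.
apply/funext => x; rewrite /effect_measurement !indicE mem_set// memNset//.
by rewrite scale1r scale0r addr0.
Qed.

Lemma povm_effect_measurement : povm (effect_measurement E).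
Proof.
have [lE cE] := bE; split=> [B _| |F mF tF x y].
- split; first split.
  + move=> a x y; rewrite /effect_measurement lE opprD addrACA -scalerBr.
    by rewrite !scalerDr !scalerA !(mulrC _ a) -!scalerA -scalerDr addrACA -scalerDr.
  + move=> x; apply: cvgD; apply: cvgZ; [exact: cvg_cst|exact: cE|exact: cvg_cst|].
    by apply: cvgB; [exact: cvg_id|exact: cE].
  + move=> x; rewrite innerDl !innerZl addr_ge0// mulr_ge0//.
    * by rewrite ler0c.
    * by rewrite ler0c.
    * exact: pE'.
- apply/funext => x; rewrite /effect_measurement !indicE !mem_set//.
  by rewrite !scale1r addrC subrK.
- have cv := cvgD (V := R[i]^o) (indic_series_cvg (t := true) (c := inner (E x) y) tF)
    (indic_series_cvg (t := false) (c := inner (x - E x) y) tF).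
  rewrite /effect_measurement innerDl !innerZl.
  refine (cvg_trans _ (cv _)); apply: near_eq_cvg; apply: nearW => n.
  rewrite fctE /series/= -big_split/=; apply: eq_bigr => k _.
  by rewrite [RHS]innerDl !innerZl.
Qed.

Lemma invariant_effect_measurement {G : topologicalGroupType} (U : G -> H -> H) :
  (forall g, unitary_operator (U g)) -> (forall g, E \o U g = U g \o E) ->
  invariant_povm U (effect_measurement E).
Proof.
move=> uU EU; split; [exact: standard_borel_bool|exact: povm_effect_measurement|].
move=> g B _; apply/funext => x.
have [[lU _] aU _] := uU g.
have EUx : E (U g x) = U g (E x) by have := congr1 (@^~ x) (EU g).
rewrite /= /effect_measurement EUx -(linB _ _ lU) -!(linZ _ _ lU) -(linD _ _ lU).
exact: (congr1 (@^~ _) aU).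
Qed.

End EffectMeasurement.

(** * The function f_E read off the Markov kernel *)

Theorem proposition4p2
  (R : realType) (G : topologicalGroupType) (hG : compact_hausdorff G)
  (haar : probability (borel G) R) (hhaar : normalized_haar haar)
  (dT : measure_display) (Theta : measurableType dT)
  (act : G -> Theta -> Theta) (hact : measurable_action act)
  (H : hilbertType R) (hH : separable_space H)
  (U : G -> H -> H) (hU : strongly_continuous_unitary_rep U)
  (rho : Theta -> H -> H) (hrho : forall t, density_operator (rho t))
  (hcov : forall g t, rho (act g t) = U g \o rho t \o adjoint (U g))
  (dZ : measure_display) (Z : measurableType dZ) (hZ : finite_discrete Z)
  (V : Z -> set H) (hV : orthogonal_decomposition V)
  (Pi : Z -> H -> H) (hPi : forall z, orthogonal_projection_on (V z) (Pi z))
  (hcentral : forall z, central_in (commutant U) (Pi z))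
  (hsuff : qc_sufficient (orbit_average haar U rho (act := act))
     (fun d (Y : measurableType d) (M : set Y -> H -> H) => invariant_povm U M)
     (block_measurement Pi)) :
  forall E : H -> H, invariant_effect U E ->
  exists f : Z -> R, (forall z, 0 <= f z <= 1) /\
    forall eta : orbit_space act,
      trace (orbit_average haar U rho eta \o E) =
      \sum_(z \in [set: Z]) trace (orbit_average haar U rho eta \o Pi z) * (f z)%:C.
Proof.
move=> E [[bE EU] pE pE'].
have [unitU _ _ _] := hU.
have pos_rho t : positive_operator (rho t) by have [] := hrho t.
have [fin_Z meas_Z] := hZ.
(* If [std_basis] is the default, every trace is 0 and f = 0 will do. *)
have [onb|nonb] := pselect (orthonormal_basis (std_basis : nat -> H)); last first.
  exists (fun=> 0); split=> [z|eta]; first by rewrite lexx ler01.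
  by rewrite trace_eq0_no_onb// fsbig1// => z _; rewrite mulr0.
have bPi z : bounded_operator (Pi z) by have [[]] := hcentral z.
have pPi z : positive_operator (Pi z).
  (* Orthogonality of x - Pi_z x to Pi_z x itself gives <x, Pi_z x> = |Pi_z x|^2. *)
  move=> x; have [VP orth] := hPi z x; have := orth _ VP.
  rewrite innerBl => /eqP; rewrite subr_eq0 => /eqP xP.
  by rewrite innerC xP -innerC innerE ler0c sqr_ge0.
have [K KE] := hsuff.2 _ _ _ (invariant_effect_measurement bE pE pE' unitU EU).
pose f z := fine (K z [set true]).
have K_le1 z : (K z [set true] <= 1)%E.
  by rewrite -(prob_kernel (s := K) z) le_measure ?inE.
have K_fin z : K z [set true] \is a fin_num.
  by rewrite ge0_fin_numE// (le_lt_trans (K_le1 z))// ltry.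
have f01 z : 0 <= f z <= 1.
  by rewrite fine_ge0//= -lee_fin fineK.
exists f; split => // eta.
set s := orbit_average haar U rho eta.
have [tr_s pos_s] : trace_class s /\ positive_operator s.
  exact: orbit_average_trace_class_positive.
pose p z := complex.Re (trace (s \o Pi z)).
have pE_ z : trace (s \o Pi z) = (p z)%:C.
  by rewrite /p RRe_real// ger0_real// trace_product_ge0.
have p0 z : 0 <= p z by rewrite -ler0c -pE_ trace_product_ge0.
pose Zs : seq Z := finmap.enum_fset (fset_set [set: Z]).
have [m [mE mint]] := sum_dirac_measure Zs p0.
have law_m : outcome_law s (block_measurement Pi) = m :> (set Z -> \bar R).
  apply/funext => B; rewrite mE /outcome_law /block_measurement.
  rewrite fsbig_mkcond (fsbig_finite _ _ fin_Z) trace_product_sum//.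
  - rewrite raddf_sum; congr (_%:E); apply: eq_bigr => z _; rewrite /patch indicE.
    by case: (z \in B); rewrite ?mulr1// mulr0 (trace_product0 tr_s).
  - by move=> z; rewrite /patch; case: ifP => // _; exact: bounded_operator0.
  - by move=> z; rewrite /patch; case: ifP => // _; exact: positive_operator0.
have mtrue : measurable [set true] by [].
have := KE eta _ mtrue; rewrite -/s law_m /outcome_law effect_measurement_true.
under eq_integral do rewrite -(fineK (K_fin _)).
have mf : measurable_fun setT f by move=> _ B _; exact: meas_Z.
have f0 z : 0 <= f z by have /andP[] := f01 z.
rewrite (mint _ mf f0).
move=> [sE]; rewrite (fsbig_finite _ _ fin_Z)/=.
(* The sufficiency identity only concerns real parts; reality of Tr (s E) lifts it to the complex
   trace. *)
have -> : trace (s \o E) = (complex.Re (trace (s \o E)))%:C.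
  by rewrite RRe_real// ger0_real// trace_product_ge0.
rewrite sE rmorph_sum/=; apply: eq_bigr => z _.
by rewrite pE_ rmorphM.
Qed.
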